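(* Let $k$ be a field of positive characteristic and let $P \in A_1(k)$ be an element of the first Weyl algebra over $k$ that does not belong to the center of $A_1(k)$. Then the centralizer $\{Q \in A_1(k) : PQ = QP\}$ of $P$ in $A_1(k)$ is a commutative algebra.
   Context: For a field $k$, the first Weyl algebra $A_1(k)$ is the associative unital $k$-algebra generated by two elements $x$ and $\partial$ (also written $\frac{d}{dx}$) subject to the single relation $\partial x - x \partial = 1$. *)

(* Defs.v *)
From HB Require Import structures.
From mathcomp Require Import all_boot all_algebra.
From mathcomp Require Import boolp finmap.
From mathcomp Require Import monalg.

Set Implicit Arguments.
Unset Strict Implicit.
Unset Printing Implicit Defensive.

Import GRing.Theory.
Local Open Scope ring_scope.
Local Open Scope quotient_scope.

Section TwoSidedIdeal.
Variables (A : nzRingType) (r : A).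

(* The two-sided ideal generated by r: the finite sums of terms u * r * v. *)
Definition ideal2 : {pred A} := fun a =>
  `[< exists s : seq (A * A), a = \sum_(uv <- s) uv.1 * r * uv.2 >].

Lemma ideal2P a :
  reflect (exists s : seq (A * A), a = \sum_(uv <- s) uv.1 * r * uv.2)
          (a \in ideal2).
Proof. exact: asboolP. Qed.

Lemma ideal2_gen : r \in ideal2.
Proof. by apply/ideal2P; exists [:: (1, 1)]; rewrite big_seq1 mul1r mulr1. Qed.

Lemma ideal2_zmod_closed : zmod_closed ideal2.
Proof.
split; first by apply/ideal2P; exists [::]; rewrite big_nil.
move=> _ _ /ideal2P[s ->] /ideal2P[t ->]; apply/ideal2P.
exists (s ++ [seq (- uv.1, uv.2) | uv <- t]).
rewrite big_cat big_map /= -sumrN; congr (_ + _).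
by apply: eq_bigr => uv _; rewrite !mulNr.
Qed.

HB.instance Definition _ :=
  GRing.isZmodClosed.Build A ideal2 ideal2_zmod_closed.

Lemma ideal2Ml b a : a \in ideal2 -> b * a \in ideal2.
Proof.
move=> /ideal2P[s ->]; apply/ideal2P.
exists [seq (b * uv.1, uv.2) | uv <- s]; rewrite big_map mulr_sumr.
by apply: eq_bigr => uv _ /=; rewrite !mulrA.
Qed.

Lemma ideal2Mr b a : a \in ideal2 -> a * b \in ideal2.
Proof.
move=> /ideal2P[s ->]; apply/ideal2P.
exists [seq (uv.1, uv.2 * b) | uv <- s]; rewrite big_map mulr_suml.
by apply: eq_bigr => uv _ /=; rewrite !mulrA.
Qed.

End TwoSidedIdeal.

Lemma ideal2Z (k : fieldType) (A : lalgType k) (r : A) c a :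
  a \in ideal2 r -> c *: a \in ideal2 r.
Proof. by rewrite -mulr_algl; apply: ideal2Ml. Qed.

Lemma malg_scaleAr (k : fieldType) (M : monomType) (c : k)
    (u v : {malg k[M]}) : c *: (u * v) = u * (c *: v).
Proof.
rewrite malgME (malgMEw (fsubset_refl _) (msuppZ_le c v)) scaler_sumr.
apply: eq_bigr => i _; rewrite scaler_sumr; apply: eq_bigr => j _.
by apply/malgP => w; rewrite !(mcoeffZ, mcoeffU) mulrnAr mulrCA.
Qed.

(* The first Weyl algebra is built as the quotient of the free associative
   algebra on two generators by the two-sided ideal generated by
   d * x - x * d - 1. *)

(* {fmonom bool} is the free monoid (words under concatenation) on two letters:
   [false] is the letter x and [true] is the letter d. *)
Definition free2 (k : fieldType) := {malg k[{fmonom bool}]}.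

Section WeylAlgebra.
Variable k : fieldType.

HB.instance Definition _ := GRing.Lalgebra.on (free2 k).

Definition free_x : free2 k := << fmu false >>.
Definition free_d : free2 k := << fmu true >>.

Definition weyl_relator : free2 k := free_d * free_x - free_x * free_d - 1.

(* The ideal is proper: the free algebra acts on {poly k}, x by multiplication
   by 'X and d by derivation, and the ideal acts by zero. *)

Definition letter_act (b : bool) (q : {poly k}) : {poly k} :=
  if b then q^`() else 'X * q.

Definition word_act (w : {fmonom bool}) (q : {poly k}) : {poly k} :=
  foldr letter_act q w.

Definition free_act (g : free2 k) (q : {poly k}) : {poly k} :=
  \sum_(w <- msupp g) g@_w *: word_act w q.

Lemma letter_act_linear b (c : k) (p q : {poly k}) :
  letter_act b (c *: p + q) = c *: letter_act b p + letter_act b q.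
Proof. by case: b => /=; rewrite ?derivD ?derivZ // mulrDr -scalerAr. Qed.

Lemma word_act_linear w (c : k) (p q : {poly k}) :
  word_act w (c *: p + q) = c *: word_act w p + word_act w q.
Proof.
rewrite /word_act; elim: (fmonom_val w) => //= b s ->.
exact: letter_act_linear.
Qed.

HB.instance Definition _ w :=
  GRing.isLinear.Build k {poly k} {poly k} *:%R (word_act w)
    (word_act_linear w).

Lemma free_actEw (D : {fset {fmonom bool}}) g q : (msupp g `<=` D)%fset ->
  free_act g q = \sum_(w <- D) g@_w *: word_act w q.
Proof.
move=> le; rewrite /free_act (big_fset_incl _ le) //= => w _ /mcoeff_outdom ->.
by rewrite scale0r.
Qed.

Lemma free_actD g h q : free_act (g + h) q = free_act g q + free_act h q.
Proof.
pose D := (msupp g `|` msupp h)%fset.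
rewrite (free_actEw _ (msuppD_le g h)) (@free_actEw D g) ?fsubsetUl //.
rewrite (@free_actEw D h) ?fsubsetUr // -big_split /=.
by apply: eq_bigr => w _; rewrite mcoeffD scalerDl.
Qed.

Lemma free_act0 q : free_act 0 q = 0.
Proof. by rewrite /free_act msupp0 big_seq_fset0. Qed.

Lemma free_actU (c : k) w q : free_act << c *g w >> q = c *: word_act w q.
Proof. by rewrite (free_actEw _ msuppU_le) big_seq_fset1 mcoeffUU. Qed.

Lemma free_act_sum (I : Type) (s : seq I) (F : I -> free2 k) q :
  free_act (\sum_(i <- s) F i) q = \sum_(i <- s) free_act (F i) q.
Proof.
exact: (big_morph (fun g => free_act g q) (fun g h => free_actD g h q)
  (free_act0 q)).
Qed.

Lemma free_actM g h q : free_act (g * h) q = free_act g (free_act h q).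
Proof.
rewrite malgME free_act_sum [RHS]/free_act; apply: eq_bigr => u _.
rewrite free_act_sum {2}/free_act linear_sum scaler_sumr; apply: eq_bigr => v _.
by rewrite free_actU linearZ scalerA /word_act fmM foldr_cat.
Qed.

Lemma free_act_relator q : free_act weyl_relator q = 0.
Proof.
have N1 g : free_act (- g) q = - free_act g q.
  by apply/eqP; rewrite -addr_eq0 -free_actD addNr free_act0.
have x_act p : free_act free_x p = 'X * p.
  by rewrite free_actU scale1r /word_act fmU.
have d_act p : free_act free_d p = p^`().
  by rewrite free_actU scale1r /word_act fmU.
have act1 p : free_act 1 p = p by rewrite free_actU scale1r /word_act fm1.
have relE g h : free_act (g * h - h * g - 1) q
              = free_act g (free_act h q) - free_act h (free_act g q) - q.
  by rewrite 2!free_actD 2!N1 act1 2!free_actM.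
by rewrite [LHS]relE !x_act !d_act derivM derivX mul1r addrK subrr.
Qed.

Lemma relator_ideal_proper : 1 \notin ideal2 weyl_relator.
Proof.
apply/ideal2P => -[s e]; suff : free_act 1 1 = 0 :> {poly k}.
  by move/eqP; rewrite free_actU scale1r /word_act fm1 /= oner_eq0.
rewrite e free_act_sum big1 // => uv _.
rewrite !free_actM free_act_relator.
by rewrite /free_act big1 // => w _; rewrite linear0 scaler0.
Qed.

Definition weyl : Type := {ideal_quot ideal2 weyl_relator}.

HB.instance Definition _ := GRing.Zmodule.on weyl.
HB.instance Definition _ := EqQuotient.on weyl.

Lemma weyl_piE (u v : free2 k) :
  (u == v %[mod weyl]) = (u - v \in ideal2 weyl_relator).
Proof. by rewrite piE. Qed.

Definition weyl_one : weyl := \pi_weyl 1.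
Definition weyl_mul := lift_op2 weyl *%R.
Definition weyl_scale (c : k) := lift_op1 weyl ( *:%R c).

Lemma weyl_piB (u v : free2 k) :
  \pi_weyl u = \pi_weyl v -> u - v \in ideal2 weyl_relator.
Proof. by move/eqP; rewrite weyl_piE. Qed.

Lemma weyl_piM u v : weyl_mul (\pi u) (\pi v) = \pi_weyl (u * v).
Proof.
unlock weyl_mul; apply/eqP; rewrite weyl_piE.
have -> : repr (\pi_weyl u) * repr (\pi_weyl v) - u * v
        = (repr (\pi_weyl u) - u) * repr (\pi_weyl v)
          + u * (repr (\pi_weyl v) - v).
  by rewrite mulrBl mulrBr addrA subrK.
apply: rpredD; first by apply: ideal2Mr; apply: weyl_piB; rewrite reprK.
by apply: ideal2Ml; apply: weyl_piB; rewrite reprK.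
Qed.

Lemma weyl_piZ c u : weyl_scale c (\pi u) = \pi_weyl (c *: u).
Proof.
unlock weyl_scale; apply/eqP; rewrite weyl_piE -scalerBr; apply: ideal2Z.
by apply: weyl_piB; rewrite reprK.
Qed.

Lemma weyl_piD (u v : free2 k) : \pi_weyl u + \pi_weyl v = \pi_weyl (u + v).
Proof. by rewrite -[RHS]/(\pi_{ideal_quot ideal2 weyl_relator} (u + v)) piE. Qed.

Lemma weyl_mulA : associative weyl_mul.
Proof.
by elim/quotW=> u; elim/quotW=> v; elim/quotW=> w; rewrite !weyl_piM mulrA.
Qed.

Lemma weyl_mul1 : left_id weyl_one weyl_mul.
Proof. by elim/quotW=> u; rewrite weyl_piM mul1r. Qed.

Lemma weyl_mulr1 : right_id weyl_one weyl_mul.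
Proof. by elim/quotW=> u; rewrite weyl_piM mulr1. Qed.

Lemma weyl_mulDl : left_distributive weyl_mul +%R.
Proof.
elim/quotW=> u; elim/quotW=> v; elim/quotW=> w.
by rewrite weyl_piD !weyl_piM weyl_piD mulrDl.
Qed.

Lemma weyl_mulDr : right_distributive weyl_mul +%R.
Proof.
elim/quotW=> u; elim/quotW=> v; elim/quotW=> w.
by rewrite weyl_piD !weyl_piM weyl_piD mulrDr.
Qed.

Lemma weyl_one_neq0 : weyl_one != 0.
Proof.
have -> : 0 = \pi_weyl 0 by rewrite -[RHS]/(\pi_{ideal_quot ideal2 weyl_relator} 0) piE.
by rewrite weyl_piE subr0 relator_ideal_proper.
Qed.

HB.instance Definition _ := GRing.Zmodule_isNzRing.Build weyl
  weyl_mulA weyl_mul1 weyl_mulr1 weyl_mulDl weyl_mulDr weyl_one_neq0.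

Lemma weyl_scaleA a b P : weyl_scale a (weyl_scale b P) = weyl_scale (a * b) P.
Proof. by elim/quotW: P => u; rewrite !weyl_piZ scalerA. Qed.

Lemma weyl_scale1 : left_id 1 weyl_scale.
Proof. by elim/quotW=> u; rewrite weyl_piZ scale1r. Qed.

Lemma weyl_scaleDr : right_distributive weyl_scale +%R.
Proof.
by move=> c; elim/quotW=> u; elim/quotW=> v;
  rewrite weyl_piD !weyl_piZ weyl_piD scalerDr.
Qed.

Lemma weyl_scaleDl P : {morph weyl_scale^~ P : a b / a + b}.
Proof. by move=> a b; elim/quotW: P => u; rewrite !weyl_piZ weyl_piD scalerDl. Qed.

HB.instance Definition _ := GRing.Zmodule_isLmodule.Build k weyl
  weyl_scaleA weyl_scale1 weyl_scaleDr weyl_scaleDl.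

Lemma weyl_scaleAl (c : k) (P Q : weyl) : c *: (P * Q) = c *: P * Q.
Proof.
elim/quotW: P => u; elim/quotW: Q => v.
rewrite -[LHS]/(weyl_scale c (weyl_mul _ _)).
rewrite -[RHS]/(weyl_mul (weyl_scale c _) _).
by rewrite weyl_piM !weyl_piZ weyl_piM scalerAl.
Qed.

HB.instance Definition _ := GRing.Lmodule_isLalgebra.Build k weyl weyl_scaleAl.

Lemma weyl_scaleAr (c : k) (P Q : weyl) : c *: (P * Q) = P * (c *: Q).
Proof.
elim/quotW: P => u; elim/quotW: Q => v.
rewrite -[LHS]/(weyl_scale c (weyl_mul _ _)).
rewrite -[RHS]/(weyl_mul _ (weyl_scale c _)).
by rewrite weyl_piM !weyl_piZ weyl_piM malg_scaleAr.
Qed.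

HB.instance Definition _ := GRing.Lalgebra_isAlgebra.Build k weyl weyl_scaleAr.

Definition weyl_x : weyl := \pi_weyl free_x.
Definition weyl_d : weyl := \pi_weyl free_d.

Lemma weyl_commutator : weyl_d * weyl_x - weyl_x * weyl_d = 1.
Proof.
apply/eqP; rewrite subr_eq.
rewrite -[X in _ == _ + X]/(weyl_mul _ _) -[X in X == _]/(weyl_mul _ _).
rewrite !weyl_piM -[1]/(\pi_weyl 1) weyl_piD weyl_piE.
have -> : free_d * free_x - (1 + free_x * free_d) = weyl_relator.
  by rewrite opprD addrA addrAC.
exact: ideal2_gen.
Qed.

End WeylAlgebra.

Definition central (A : nzRingType) (P : A) : Prop :=
  forall Q : A, P * Q = Q * P.

Definition centralizer (A : nzRingType) (P : A) : {pred A} :=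
  [pred Q | P * Q == Q * P].

(* Main.v *)
Require Import Defs.
From mathcomp Require Import all_boot all_algebra.
From HB Require Import structures.
From mathcomp Require Import falgebra finmap monalg ring.

Set Implicit Arguments.
Unset Strict Implicit.
Unset Printing Implicit Defensive.

Import GRing.Theory.
Local Open Scope ring_scope.
Local Open Scope quotient_scope.

(** In characteristic p the elements x^p and d^p are central in A_1(k), and
    inverting the nonzero elements of k[x^p, d^p] turns A_1(k) into a division
    algebra D of dimension p^2 over K = k(s, t), with s = x^p and t = d^p.  If C
    is the centralizer in D of a noncentral a and L = K(a), then
    K < L <= C < D is a chain of division algebras whose dimensions over K
    divide one another and divide p^2.  This forces dim L = dim C, so C = L,
    which is commutative. *)

Lemma additive0 (U V : zmodType) (g : U -> V) :
  {morph g : u v / u + v} -> g 0 = 0.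
Proof. by move=> gD; apply: (addrI (g 0)); rewrite -gD !addr0. Qed.

Lemma additive_sum (U V : zmodType) (g : U -> V) (I : Type) (s : seq I)
    (F : I -> U) : {morph g : u v / u + v} ->
  g (\sum_(i <- s) F i) = \sum_(i <- s) g (F i).
Proof. by move=> gD; exact: (big_morph g gD (additive0 gD)). Qed.

(** * Actions of the Weyl algebra *)

Definition weyl_gen (k : fieldType) (b : bool) : weyl k :=
  if b then weyl_d k else weyl_x k.

Section WeylAction.
Variables (k : fieldType) (R : comNzRingType) (h : {rmorphism k -> R}).
Variables (M : lmodType R) (f : bool -> M -> M).

Definition word_action (w : {fmonom bool}) (m : M) : M := foldr f m w.

(** Scalars of k act through [h]; R is kept separate from k because the construction is applied both
    over k[x] and over k(s, t). *)
Definition free_action (g : free2 k) (m : M) : M :=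
  \sum_(w <- msupp g) h g@_w *: word_action w m.

Definition action (P : weyl k) (m : M) : M := free_action (repr P) m.

Lemma free_actionEw (D : {fset {fmonom bool}}) g m : (msupp g `<=` D)%fset ->
  free_action g m = \sum_(w <- D) h g@_w *: word_action w m.
Proof.
move=> le; rewrite /free_action (big_fset_incl _ le) //= => w _.
by move=> /mcoeff_outdom ->; rewrite rmorph0 scale0r.
Qed.

Lemma free_actionDl m : {morph free_action^~ m : g g' / g + g'}.
Proof.
move=> g g' /=; pose D := (msupp g `|` msupp g')%fset.
rewrite (free_actionEw _ (msuppD_le g g')) (@free_actionEw D g) ?fsubsetUl //.
rewrite (@free_actionEw D g') ?fsubsetUr // -big_split /=.
by apply: eq_bigr => w _; rewrite mcoeffD rmorphD scalerDl.
Qed.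

Lemma free_actionNl g m : free_action (- g) m = - free_action g m.
Proof.
apply/eqP; rewrite -addr_eq0 -free_actionDl addNr.
by rewrite (additive0 (@free_actionDl m)).
Qed.

Lemma free_actionU c w m : free_action << c *g w >> m = h c *: word_action w m.
Proof. by rewrite (free_actionEw _ msuppU_le) big_seq_fset1 mcoeffUU. Qed.

Lemma free_action1 m : free_action 1 m = m.
Proof. by rewrite free_actionU rmorph1 scale1r /word_action fm1. Qed.

Hypothesis fD : forall b, {morph f b : m n / m + n}.
Hypothesis fZ : forall b c m, f b (h c *: m) = h c *: f b m.
Hypothesis f_comm : forall m, f true (f false m) - f false (f true m) = m.

Lemma word_actionD w : {morph word_action w : m n / m + n}.
Proof.
move=> m n; rewrite /word_action.
by elim: (fmonom_val w) => //= b s ->; rewrite fD.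
Qed.

Lemma word_actionZ w c m : word_action w (h c *: m) = h c *: word_action w m.
Proof.
by rewrite /word_action; elim: (fmonom_val w) => //= b s ->; rewrite fZ.
Qed.

Lemma free_actionDr g : {morph free_action g : m n / m + n}.
Proof.
move=> m n; rewrite /free_action -big_split.
by apply: eq_bigr => w _; rewrite word_actionD scalerDr.
Qed.

Lemma free_actionM g g' m :
  free_action (g * g') m = free_action g (free_action g' m).
Proof.
rewrite malgME (additive_sum _ _ (@free_actionDl m)) [RHS]/free_action.
apply: eq_bigr => u _; rewrite (additive_sum _ _ (@free_actionDl m)).
rewrite {2}/free_action (additive_sum _ _ (@word_actionD u)) scaler_sumr.
apply: eq_bigr => v _; rewrite free_actionU word_actionZ scalerA rmorphM.
by rewrite /word_action fmM foldr_cat.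
Qed.

Lemma free_action_relator m : free_action (weyl_relator k) m = 0.
Proof.
have actU b n : free_action << fmu b >> n = f b n.
  by rewrite free_actionU rmorph1 scale1r /word_action fmU.
have relE g g' : free_action (g * g' - g' * g - 1) m =
    free_action g (free_action g' m) - free_action g' (free_action g m) - m.
  rewrite (free_actionDl _ _ (- 1)) (free_actionDl _ _ (- (g' * g))).
  rewrite (free_actionNl 1) (free_actionNl (g' * g)).
  by rewrite free_action1; congr (_ - _ - _); apply: free_actionM.
by rewrite [LHS]relE !actU f_comm subrr.
Qed.

Lemma free_action_ideal g m :
  g \in ideal2 (weyl_relator k) -> free_action g m = 0.
Proof.
move=> /ideal2P[s ->]; rewrite (additive_sum _ _ (@free_actionDl m)).
rewrite big1 // => uv _.
by rewrite !free_actionM free_action_relator (additive0 (@free_actionDr _)).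
Qed.

(** The representative chosen by [repr] does not matter: two representatives differ by an element of
    the relator ideal, which acts as zero. *)
Lemma action_pi g m : action (\pi_(weyl k) g) m = free_action g m.
Proof.
apply/eqP; rewrite -subr_eq0 -free_actionNl -free_actionDl.
by rewrite free_action_ideal // weyl_piB ?reprK.
Qed.

Lemma actionDl m : {morph action^~ m : P Q / P + Q}.
Proof.
elim/quotW => u; elim/quotW => v.
by rewrite /= weyl_piD !action_pi free_actionDl.
Qed.

Lemma actionDr P : {morph action P : m n / m + n}.
Proof. exact: free_actionDr. Qed.

Lemma actionM P Q m : action (P * Q) m = action P (action Q m).
Proof.
elim/quotW: P => u; elim/quotW: Q => v.
by rewrite [_ * _]weyl_piM !action_pi free_actionM.
Qed.

Lemma action1 m : action 1 m = m.
Proof. by rewrite action_pi free_action1. Qed.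

Lemma actionZ c P m : action (c *: P) m = h c *: action P m.
Proof.
elim/quotW: P => u; rewrite [_ *: _]weyl_piZ !action_pi.
by rewrite -mul_malgC free_actionM free_actionU /word_action fm1.
Qed.

Lemma action_gen b m : action (weyl_gen k b) m = f b m.
Proof.
by case: b; rewrite action_pi free_actionU rmorph1 scale1r /word_action fmU.
Qed.

End WeylAction.

(** Scalars outside the image of [h] also commute with each word as soon as they commute with the
    two letters. Over k(s, t) this makes the action linear over the whole field. *)
Lemma action_scalable (k : fieldType) (R : comNzRingType)
    (h : {rmorphism k -> R}) (M : lmodType R) (f : bool -> M -> M) (c : R) :
  (forall b m, f b (c *: m) = c *: f b m) ->
  forall P m, action h f P (c *: m) = c *: action h f P m.
Proof.
move=> fc P m; rewrite /action /free_action scaler_sumr; apply: eq_bigr => w _.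
rewrite [RHS]scalerA mulrC -scalerA; congr (_ *: _); rewrite /word_action.
by elim: (fmonom_val w) => //= b s ->.
Qed.

(** Words in x and d span the algebra and are built by adding letters on the left, so closure under
    left multiplication by the generators is enough. *)
Lemma weyl_ind (k : fieldType) (S : weyl k -> Prop) :
  S 1 -> (forall P Q, S P -> S Q -> S (P + Q)) ->
  (forall c P, S P -> S (c *: P)) ->
  (forall b P, S P -> S (weyl_gen k b * P)) -> forall P, S P.
Proof.
move=> S1 SD SZ SM; elim/quotW => g.
have S0 : S (\pi_(weyl k) 0).
  have -> : \pi_(weyl k) 0 = 0 *: 1 by rewrite [RHS]weyl_piZ scale0r.
  exact: SZ.
rewrite [g]monalgE; elim/big_ind: _ => // [u v Su Sv|w _].
  by rewrite -weyl_piD; apply: SD.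
have -> : << g@_w *g w >> = g@_w *: << w >> :> free2 k.
  by rewrite -mul_malgC [RHS]fgmulUU mulr1 /= mul1m.
rewrite -weyl_piZ; apply: SZ; case: w => s; elim: s => [|b s IHs].
  by have -> : FMonom [::] = fmone bool by rewrite fmoneE.
have -> : << FMonom (b :: s) >> = << fmu b >> * << FMonom s >> :> free2 k.
  rewrite [RHS]fgmulUU mulr1; congr << _ >>; apply/eqP.
  by rewrite fmP fmM fmU.
rewrite -weyl_piM; have := SM b _ IHs; by case: b.
Qed.

(** * Normal ordering, and the absence of zero divisors *)

(** The Leibniz rule in commutator form: if c' is the derivative of c, then c + c' x is that of c x
    + a. *)
Lemma commutator_step (K : fieldType) (C : algType K) (x d c c' : C) (a : K) :
  d * x = x * d + 1 -> d * c = c * d + c' ->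
  d * (c * x + a%:A) = (c * x + a%:A) * d + (c + c' * x).
Proof.
move=> dx dc; rewrite mulrDr mulrA dc mulr_algr mulrDl.
rewrite -(mulrA _ d) dx mulrDr mulr1 mulrDl mulr_algl -[in RHS]mulrA.
by rewrite -!addrA; congr (_ + _); rewrite [RHS]addrC -addrA.
Qed.

Section NormalForm.
Variable k : fieldType.
Local Notation A := (weyl k).
Local Notation B := {poly {poly k}}.
Local Notation x := (weyl_x k).
Local Notation d := (weyl_d k).

Lemma weyl_dx : d * x = x * d + 1.
Proof. by rewrite -(weyl_commutator k) addrC subrK. Qed.

(* The Weyl algebra acts on k[x][y], x by multiplication and d as y + d/dx;
   applied to 1, the normally ordered sum_j q_j(x) d^j gives its symbol
   sum_j q_j(x) y^j. *)
Definition symbol_gen (b : bool) (q : B) : B :=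
  if b then map_poly (@deriv k) q + 'X * q else 'X *: q.

(** Horner evaluation keeps coefficients to the left of the argument, so this is the normally
    ordered sum of the q_j(x) d^j although x and d do not commute. *)
Definition weyl_of (q : B) : A := (map_poly (horner_alg x) q).[d].

Definition symbol_act : A -> B -> B := action (@polyC k) symbol_gen.

Lemma symbol_genD b : {morph symbol_gen b : q r / q + r}.
Proof.
by case: b => q r /=; rewrite ?scalerDr // raddfD mulrDr addrACA.
Qed.

Lemma symbol_genZ b c q : symbol_gen b (c%:P *: q) = c%:P *: symbol_gen b q.
Proof.
case: b => /=; last by rewrite !scalerA mulrC.
rewrite scalerDr scalerAr; congr (_ + _); apply/polyP => i.
by rewrite !(coef_map, coefZ) /= mul_polyC derivZ mul_polyC.
Qed.

Lemma symbol_gen_comm q :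
  symbol_gen true (symbol_gen false q) -
    symbol_gen false (symbol_gen true q) = q.
Proof.
rewrite /= scalerDr scalerAr opprD addrACA subrr addr0; apply/polyP => i.
by rewrite coefB !(coef_map, coefZ) /= derivM derivX mul1r addrK.
Qed.

Lemma symbol_actD q : {morph symbol_act^~ q : P Q / P + Q}.
Proof. exact: actionDl symbol_genD symbol_genZ symbol_gen_comm q. Qed.

Lemma symbol_actM P Q q : symbol_act (P * Q) q = symbol_act P (symbol_act Q q).
Proof. exact: actionM symbol_genD symbol_genZ symbol_gen_comm P Q q. Qed.

Lemma symbol_actZ c P q : symbol_act (c *: P) q = c%:P *: symbol_act P q.
Proof. exact: actionZ symbol_genD symbol_genZ symbol_gen_comm c P q. Qed.

Lemma symbol_act1 q : symbol_act 1 q = q.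
Proof. exact: action1 symbol_genD symbol_genZ symbol_gen_comm q. Qed.

Lemma symbol_act_gen b q : symbol_act (weyl_gen k b) q = symbol_gen b q.
Proof. exact: action_gen symbol_genD symbol_genZ symbol_gen_comm b q. Qed.

Lemma weyl_ofD : {morph weyl_of : q r / q + r}.
Proof. by move=> q r; rewrite /weyl_of rmorphD hornerD. Qed.

Lemma weyl_ofC c : weyl_of c%:P = horner_alg x c.
Proof. by rewrite /weyl_of map_polyC hornerC. Qed.

Lemma weyl_ofMX q : weyl_of (q * 'X) = weyl_of q * d.
Proof. by rewrite /weyl_of rmorphM /= map_polyX hornerMX. Qed.

Lemma weyl_ofZ c q : weyl_of (c *: q) = horner_alg x c * weyl_of q.
Proof. by rewrite /weyl_of map_polyZ hornerZ. Qed.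

Lemma weyl_d_horner (c : {poly k}) :
  d * horner_alg x c = horner_alg x c * d + horner_alg x c^`().
Proof.
elim/poly_ind: c => [|c a IHc].
  by rewrite deriv0 !rmorph0 mulr0 mul0r addr0.
rewrite derivMXaddC !rmorphD !rmorphM /= !horner_algX horner_algC.
exact: commutator_step weyl_dx IHc.
Qed.

(** [weyl_of] intertwines the action on symbols with left multiplication. A factor y becomes right
    multiplication by d, which commutes with left multiplication, so the induction reduces to d c =
    c d + c' for c in k[x]. *)
Lemma weyl_of_gen b q : weyl_of (symbol_gen b q) = weyl_gen k b * weyl_of q.
Proof.
case: b; last by rewrite weyl_ofZ horner_algX.
elim/poly_ind: q => [|q c IHq].
  by rewrite /= raddf0 mulr0 addr0 /weyl_of !rmorph0 horner0 mulr0.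
have -> : symbol_gen true (q * 'X + c%:P)
        = symbol_gen true q * 'X + (c^`()%:P + c%:P * 'X).
  have -> : symbol_gen true (q * 'X + c%:P)
      = map_poly (@deriv k) (q * 'X) + c^`()%:P + 'X * (q * 'X + c%:P).
    by rewrite /= raddfD /= map_polyC.
  have -> : map_poly (@deriv k) (q * 'X) = map_poly (@deriv k) q * 'X.
    apply/polyP => i; rewrite !(coef_map, coefMX) /=.
    by case: eqP => _ /=; rewrite ?deriv0.
  by rewrite /=; ring.
rewrite !weyl_ofD !weyl_ofMX !weyl_ofC IHq mulrDr weyl_d_horner mulrA.
by congr (_ + _); rewrite addrC.
Qed.

Lemma weyl_of_act P q : weyl_of (symbol_act P q) = P * weyl_of q.
Proof.
move: q; elim/weyl_ind: P => [|P Q IHP IHQ|c P IHP|b P IHP] q.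
- by rewrite symbol_act1 mul1r.
- by rewrite symbol_actD weyl_ofD IHP IHQ mulrDl.
- by rewrite symbol_actZ weyl_ofZ horner_algC IHP mulr_algl scalerAl.
by rewrite symbol_actM -mulrA -IHP -weyl_of_gen symbol_act_gen.
Qed.

Definition symbol (P : A) : B := symbol_act P 1.

Lemma symbolK : cancel symbol weyl_of.
Proof. by move=> P; rewrite weyl_of_act weyl_ofC rmorph1 mulr1. Qed.

Lemma symbol_act0 q : symbol_act 0 q = 0.
Proof. exact: additive0 (symbol_actD q). Qed.

Lemma symbol_act_horner c q : symbol_act (horner_alg x c) q = c *: q.
Proof.
move: q; elim/poly_ind: c => [|c a IHc] q.
  by rewrite rmorph0 symbol_act0 scale0r.
rewrite rmorphD rmorphM /= horner_algX horner_algC symbol_actD symbol_actM.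
by rewrite IHc (symbol_act_gen false) symbol_actZ symbol_act1 scalerA -scalerDl.
Qed.

Lemma size_symbol_gen_d (q : B) :
  q != 0 -> size (symbol_gen true q) = (size q).+1.
Proof.
move=> q_neq0; rewrite /= addrC mulrC size_polyDl size_mulX // ltnS.
exact: size_poly.
Qed.

(** Degrees in y add up: d raises the degree by exactly one, since y r dominates the derivative
    term, and coefficients in k[x] do not raise it. In q y + c the part q y therefore dominates
    unless q = 0. *)
Lemma size_symbol_act_weyl_of (q r : B) : q != 0 -> r != 0 ->
  size (symbol_act (weyl_of q) r) = (size q + size r).-1.
Proof.
elim/poly_ind: q r => [|q c IHq] r; first by rewrite eqxx.
move=> qc_neq0 r_neq0; rewrite weyl_ofD weyl_ofMX weyl_ofC.
rewrite symbol_actD symbol_actM (symbol_act_gen true) symbol_act_horner.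
have [q0 | q_neq0] := eqVneq q 0.
  move: qc_neq0; rewrite q0 mul0r add0r polyC_eq0 => c_neq0.
  rewrite /weyl_of rmorph0 horner0 symbol_act0 add0r.
  by rewrite size_scale // size_polyC c_neq0.
have dr_neq0 : symbol_gen true r != 0.
  by rewrite -size_poly_eq0 size_symbol_gen_d.
rewrite size_MXaddC (negPf q_neq0) /= size_polyDl.
  by rewrite IHq // size_symbol_gen_d // addnS.
rewrite IHq // size_symbol_gen_d // addnS /=.
rewrite (leq_ltn_trans (size_scale_leq _ _)) //.
by rewrite -[X in (X < _)%N]add0n ltn_add2r lt0n size_poly_eq0.
Qed.

(** The symbol of P Q is P acting on the symbol of Q, and additivity of degrees keeps it nonzero
    when both symbols are. *)
Lemma weyl_integral (P Q : A) : P * Q = 0 -> P = 0 \/ Q = 0.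
Proof.
move=> PQ0; have [sP0 | sP_neq0] := eqVneq (symbol P) 0.
  by left; rewrite -(symbolK P) sP0 /weyl_of rmorph0 horner0.
have [sQ0 | sQ_neq0] := eqVneq (symbol Q) 0.
  by right; rewrite -(symbolK Q) sQ0 /weyl_of rmorph0 horner0.
have := size_symbol_act_weyl_of sP_neq0 sQ_neq0.
rewrite symbolK -symbol_actM PQ0 symbol_act0 size_poly0.
move: sP_neq0 sQ_neq0; rewrite -!size_poly_gt0.
by case: (size _) (size (symbol Q)) => [|m] [|n] //; rewrite addnS.
Qed.

(** Uniqueness of the normal form: [weyl_of] kills the difference by [symbolK], yet a nonzero q
    gives an operator whose value at 1 has the size of q. *)
Lemma weyl_ofK : cancel weyl_of symbol.
Proof.
move=> q; apply/eqP; rewrite -subr_eq0; apply/negP => /negP neq0.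
have := size_symbol_act_weyl_of neq0 (oner_neq0 _).
have -> : weyl_of (symbol (weyl_of q) - q) = 0.
  apply: (addIr (weyl_of q)); rewrite -weyl_ofD subrK add0r.
  exact: symbolK.
rewrite symbol_act0 size_poly0 size_poly1 addn1 /= => /esym/eqP.
by rewrite size_poly_eq0 (negPf neq0).
Qed.

End NormalForm.

(** * A module of dimension p^2 over k(s, t) *)

Lemma val_ord_pred n (i : 'I_n.+1) : i != ord0 -> ord_pred i = i.-1 :> nat.
Proof.
case: i => [[|i] lt_in] // _; rewrite /ord_pred.
change ((i.+1 + n.+1).-1 %% n.+1 = i)%N.
by rewrite addSn modnDr modn_small // ltnW.
Qed.

(** * Splitting polynomials by exponents modulo p *)

Section ResiduePart.
Variables (R : comNzRingType) (n : nat).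
Local Notation p := n.+1.

(* f = sum_(a < p) X^a * g_a(X^p) with g_a := residue_part a f. *)
Definition residue_part (a : nat) (f : {poly R}) : {poly R} :=
  \poly_(u < size f) f`_(p * u + a).

(** Truncating at [size f] loses nothing, because p u + a >= u. *)
Lemma coef_residue_part a f u : (residue_part a f)`_u = f`_(p * u + a).
Proof.
rewrite coef_poly; case: ltnP => // le_fu; rewrite nth_default //.
by rewrite (leq_trans le_fu) // mulSn -addnA leq_addr.
Qed.

Lemma residue_part_linear a : linear (residue_part a).
Proof.
by move=> c f g; apply/polyP => u; rewrite !(coef_residue_part, coefD, coefZ).
Qed.

HB.instance Definition _ a :=
  GRing.isLinear.Build R {poly R} {poly R} *:%R (residue_part a)
    (residue_part_linear a).

(** Multiplication by X shifts the classes cyclically; passing from exponent p - 1 to p produces a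
    factor X^p, recorded as 'X. *)
Lemma residue_partMX (a : 'I_p) f :
  residue_part a ('X * f) =
    (if a == ord0 then 'X else 1) * residue_part (ord_pred a) f.
Proof.
apply/polyP => u; rewrite coef_residue_part coefXM.
have [-> | a_neq0] := eqVneq a ord0.
  rewrite addn0 coefXM; case: u => [|u]; first by rewrite muln0.
  have -> : (p * u.+1).-1 = (p * u + n)%N by rewrite mulnS addSn addnC.
  by rewrite coef_residue_part /= modn_small // mulnS.
have a_gt0 : (0 < a)%N by rewrite lt0n.
rewrite mul1r coef_residue_part val_ord_pred //.
rewrite addn_eq0 (gtn_eqF a_gt0) andbF.
by case: (a : nat) a_gt0 => // m _; rewrite addnS.
Qed.

(** The factor p u + a + 1 equals a + 1 because p = 0; it vanishes exactly where the cyclic index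
    would wrap around, so no factor 'X appears. *)
Lemma residue_part_deriv (a : 'I_p) f : p%:R = 0 :> R ->
  residue_part a f^`() = a.+1%:R *: residue_part (ordS a) f.
Proof.
move=> p0; apply/polyP => u.
rewrite coefZ !coef_residue_part coef_deriv /= -[LHS]mulr_natl.
rewrite -addnS natrD natrM p0 mul0r add0r.
have [eq_ap | neq_ap] := eqVneq a.+1 p; first by rewrite {1 3}eq_ap p0 !mul0r.
by rewrite modn_small // ltn_neqAle neq_ap ltn_ord.
Qed.

Lemma residue_partXn (a b : 'I_p) : residue_part a 'X^b = (a == b)%:R.
Proof.
apply/polyP => u; rewrite coef_residue_part coefXn -polyC_natr coefC.
case: u => [|u]; first by rewrite muln0.
rewrite mulnS -!addnA gtn_eqF //=.
by rewrite (leq_trans (ltn_ord b)) // leq_addr.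
Qed.

Lemma residue_part1 (a : 'I_p) : residue_part a 1 = (a == ord0)%:R.
Proof. by rewrite -(expr0 'X) (residue_partXn a ord0). Qed.

Lemma residue_partC (a : 'I_p) c : residue_part a c%:P = (a == ord0)%:R * c%:P.
Proof.
by rewrite -alg_polyC linearZ /= residue_part1 alg_polyC -mul_polyC mulrC.
Qed.

Lemma residue_partXp (a : 'I_p) : residue_part a 'X^p = (a == ord0)%:R *: 'X.
Proof.
rewrite exprS residue_partMX; have [-> | a_neq0] := eqVneq a ord0.
  rewrite scale1r (_ : 'X^n = 'X^(ord_max : 'I_p)) // residue_partXn.
  by rewrite -val_eqE /= modn_small // eqxx mulr1.
rewrite scale0r mul1r (_ : 'X^n = 'X^(ord_max : 'I_p)) // residue_partXn.
rewrite -(inj_eq (@ordS_inj _)) ord_predK.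
suff -> : ordS ord_max = ord0 :> 'I_p by rewrite (negPf a_neq0).
by apply/val_inj; rewrite /= modnn.
Qed.

Lemma residue_part_eq0 f : (forall a : 'I_p, residue_part a f = 0) -> f = 0.
Proof.
move=> f0; apply/polyP => i; rewrite coef0 (divn_eq i p) mulnC.
rewrite -(coef_residue_part (i %% p)).
by rewrite (f0 (Ordinal (ltn_pmod i (ltn0Sn n)))) coef0.
Qed.

End ResiduePart.

Lemma comm_expr_step (C : nzRingType) (x d : C) : d * x = x * d + 1 ->
  forall i, d ^+ i.+1 * x = x * d ^+ i.+1 + (d ^+ i) *+ i.+1.
Proof.
move=> dx; elim=> [|i IHi]; first by rewrite dx.
rewrite exprS -mulrA IHi mulrDr mulrA dx mulrDl mul1r -mulrA -exprS -addrA.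
by rewrite mulrnAr -exprS -mulrS.
Qed.

(** * The Weyl algebra acting on K[x, y] / (x^p - s, y^p - t) *)

Section Rep.
Variables (k : fieldType) (n : nat).
Local Notation p := n.+1.
Hypothesis p0 : p%:R = 0 :> k.
Local Notation A := (weyl k).
Local Notation B := {poly {poly k}}.
Local Notation K := {fraction B}.
Local Notation V := 'M[K]_p.
Local Notation x := (weyl_x k).
Local Notation d := (weyl_d k).

(* The matrix unit E_ij stands for x^i y^j in K[x, y] / (x^p - s, y^p - t), with
   s := 'X%:P and t := 'X in {poly {poly k}}; x acts by multiplication and d as
   y + d/dx.  The factor [wrap] produces s or t when an exponent reaches p.  For
   i = p - 1 the cyclic index ordS i is harmless, as its coefficient p is 0. *)
Definition wrap (c : K) (i : 'I_p) : K := if i == ord0 then c else 1.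

Definition rep_gen (b : bool) (M : V) : V :=
  if b then
    \matrix_(i, j) (i.+1%:R * M (ordS i) j +
      wrap (tofrac 'X) j * M i (ord_pred j))
  else \matrix_(i, j) (wrap (tofrac 'X%:P) i * M (ord_pred i) j).

Definition frac_const (c : k) : K := tofrac c%:P%:P.

HB.instance Definition _ :=
  GRing.RMorphism.copy frac_const (@FracField.tofrac B \o polyC \o polyC).

Definition rep : A -> V -> V := action frac_const rep_gen.

Let Kp0 : p%:R = 0 :> K.
Proof. by rewrite -(rmorph_nat frac_const) p0 rmorph0. Qed.

Lemma rep_genD b : {morph rep_gen b : M N / M + N}.
Proof. by case: b => M N; apply/matrixP => i j; rewrite !mxE; ring. Qed.

Lemma rep_genZ b c M : rep_gen b (c *: M) = c *: rep_gen b M.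
Proof. by case: b; apply/matrixP => i j; rewrite !mxE; ring. Qed.

(** [ordS i] is zero only for i = p - 1, where the coefficient i + 1 = p vanishes and hides the
    factor c. *)
Lemma wrap_ordS c (i : 'I_p) : i.+1%:R * wrap c (ordS i) = i.+1%:R.
Proof.
rewrite /wrap; case: eqP => [/(congr1 val) /= i0|_]; last by rewrite mulr1.
have -> : i.+1 = p; last by rewrite Kp0 mul0r.
apply/eqP; rewrite eqn_leq ltn_ord leqNgt; apply/negP => lt_ip.
by move: i0; rewrite modn_small.
Qed.

Lemma wrap_ord_pred c (i : 'I_p) : wrap c i * (ord_pred i).+1%:R = i%:R.
Proof.
rewrite /wrap; case: eqP => [->|/eqP i_neq0].
  by rewrite /= modn_small // Kp0 mulr0.
by rewrite mul1r val_ord_pred // prednK // lt0n.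
Qed.

Lemma rep_gen_comm M :
  rep_gen true (rep_gen false M) - rep_gen false (rep_gen true M) = M.
Proof.
apply/matrixP => i j; rewrite !mxE ordSK ord_predK.
set s := tofrac 'X%:P; set t := wrap _ j * M _ _.
(* The y-terms cancel, and the two [wrap] identities reduce the remaining coefficient to (i + 1) -
   i. *)
transitivity
  ((i.+1%:R * wrap s (ordS i) - wrap s i * (ord_pred i).+1%:R) * M i j).
  by rewrite /t; ring.
by rewrite wrap_ordS wrap_ord_pred -natr1; ring.
Qed.

Let fZ b c M := rep_genZ b (frac_const c) M.
Let actD := actionDl rep_genD fZ rep_gen_comm.
Let actM := actionM rep_genD fZ rep_gen_comm.

Lemma repDl M : {morph rep^~ M : P Q / P + Q}.
Proof. exact: actD. Qed.

Lemma repM P Q M : rep (P * Q) M = rep P (rep Q M).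
Proof. exact: actM. Qed.

Lemma repZ c P M : rep (c *: P) M = frac_const c *: rep P M.
Proof. exact: actionZ rep_genD fZ rep_gen_comm _ _ _. Qed.

Lemma rep1 M : rep 1 M = M.
Proof. exact: action1 rep_genD fZ rep_gen_comm _. Qed.

Lemma rep_weyl_gen b M : rep (weyl_gen k b) M = rep_gen b M.
Proof. exact: action_gen rep_genD fZ rep_gen_comm _ _. Qed.

Lemma rep_linear P : linear (rep P).
Proof.
move=> c M N; rewrite /rep (actionDr _ rep_genD) action_scalable //.
by move=> b L; apply: rep_genZ.
Qed.

HB.instance Definition _ P :=
  GRing.isLinear.Build K V V *:%R (rep P) (rep_linear P).

(* The reduction k[x][y] -> K[x, y] / (x^p - s, y^p - t). *)
Definition residues (q : B) : V :=
  \matrix_(i, j) tofrac (residue_part n j (map_poly (residue_part n i) q)).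

Lemma residuesD : {morph residues : q r / q + r}.
Proof. by move=> q r; apply/matrixP => i j; rewrite !mxE !raddfD. Qed.

Lemma residue_part_map a (q : B) c : 
  map_poly (residue_part n a) (c%:P *: q) =
    c%:P *: map_poly (residue_part n a) q.
Proof.
by apply/polyP => i; rewrite coefZ !coef_map coefZ /= !mul_polyC linearZ.
Qed.

Lemma residuesZ c q : residues (c%:P *: q) = frac_const c *: residues q.
Proof.
apply/matrixP => i j; rewrite !mxE residue_part_map linearZ /= -mul_polyC.
by rewrite tofracM.
Qed.

Lemma residue_part_mapMX a (q : B) :
  map_poly (residue_part n a) ('X * q) = 'X * map_poly (residue_part n a) q.
Proof.
apply/polyP => i; rewrite !(coef_map, coefXM) /=.
by case: eqP => _ //; rewrite raddf0.
Qed.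

(** Rows record the exponent of x modulo p and columns that of y, so each generator reduces to the
    cyclic shift and derivative rules for [residue_part]. *)
Lemma residues_gen b q : residues (symbol_gen b q) = rep_gen b (residues q).
Proof.
apply/matrixP => i j; rewrite /rep_gen; case: b; rewrite !mxE.
  have -> : map_poly (residue_part n i) (symbol_gen true q) =
      i.+1%:R%:P *: map_poly (residue_part n (ordS i)) q
      + 'X * map_poly (residue_part n i) q.
    rewrite /= raddfD /= residue_part_mapMX; congr (_ + _).
    apply/polyP => u; rewrite coefZ !coef_map /= residue_part_deriv //.
    by rewrite mul_polyC.
  rewrite linearD linearZ /= residue_partMX /= -mul_polyC tofracD !tofracM.
  congr (_ * _ + _ * _); first by rewrite !polyC_natr rmorph_nat.
  by rewrite /wrap; case: eqP; rewrite ?tofrac1.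
have -> : map_poly (residue_part n i) (symbol_gen false q) =
    (if i == ord0 then 'X else 1) *: map_poly (residue_part n (ord_pred i)) q.
  by apply/polyP => u; rewrite /= coefZ !coef_map coefZ /= residue_partMX.
rewrite linearZ /= -mul_polyC tofracM; congr (_ * _).
by rewrite /wrap; case: eqP; rewrite ?tofrac1.
Qed.

Lemma rep_residues P q : rep P (residues q) = residues (symbol_act P q).
Proof.
move: q; elim/weyl_ind: P => [|P Q IHP IHQ|c P IHP|b P IHP] q.
- by rewrite rep1 symbol_act1.
- by rewrite repDl IHP IHQ -residuesD symbol_actD.
- by rewrite repZ IHP -residuesZ symbol_actZ.
by rewrite repM IHP rep_weyl_gen -residues_gen symbol_actM symbol_act_gen.
Qed.

Lemma rep_weyl_of q : rep (weyl_of q) (residues 1) = residues q.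
Proof. by rewrite rep_residues -/(symbol _) weyl_ofK. Qed.

Lemma residues_monomial (i j : 'I_p) :
  residues ('X^i *: 'X^j) = delta_mx i j.
Proof.
apply/matrixP => a b; rewrite !mxE.
have -> : map_poly (residue_part n a) ('X^i *: 'X^j) = (a == i)%:R *: 'X^j :> B.
  apply/polyP => u; rewrite coef_map !coefZ coefXn /=.
  by case: eqP => _; rewrite ?mulr0 ?raddf0 // !mulr1 residue_partXn.
rewrite linearZ /= residue_partXn -mul_polyC tofracM polyC_natr.
by rewrite !rmorph_nat -natrM mulnb.
Qed.

Lemma residuesC c (i j : 'I_p) :
  residues c%:P i j = tofrac ((j == ord0)%:R * (residue_part n i c)%:P).
Proof. by rewrite mxE map_polyC residue_partC. Qed.

(** k[x][y] is free over k[s, t] on the x^i y^j with i, j < p, and the entries of [residues q] are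
    the coordinates of q. *)
Lemma residues_inj0 q : residues q = 0 -> q = 0.
Proof.
move=> q0; apply/polyP => v; rewrite coef0.
apply: (@residue_part_eq0 _ n) => i.
have -> : residue_part n i q`_v = (map_poly (residue_part n i) q)`_v.
  by rewrite coef_map.
rewrite (_ : map_poly _ _ = 0) ?coef0 //; apply: (@residue_part_eq0 _ n) => j.
apply/eqP; rewrite -tofrac_eq0.
by move/matrixP: q0 => /(_ i j); rewrite !mxE => ->.
Qed.

(** The value at [residues 1] is the reduction of the symbol of P, which determines P. *)
Lemma rep_eq0 P : rep P (residues 1) = 0 -> P = 0.
Proof.
rewrite rep_residues => /residues_inj0 sP0.
by rewrite -(symbolK P) /symbol sP0 /weyl_of rmorph0 horner0.
Qed.

Lemma delta_rep (i j : 'I_p) :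
  delta_mx i j = rep (weyl_of ('X^i *: 'X^j)) (residues 1).
Proof. by rewrite rep_weyl_of residues_monomial. Qed.

(** Every matrix unit comes from [residues 1] by an element of the algebra, past which P can be
    moved; one value thus determines the action. *)
Lemma rep_central_scalar P c : central P ->
  rep P (residues 1) = c *: residues 1 -> forall M, rep P M = c *: M.
Proof.
move=> cP Pc M; rewrite [M]matrix_sum_delta linear_sum scaler_sumr.
apply: eq_bigr => i _; rewrite linear_sum scaler_sumr; apply: eq_bigr => j _.
rewrite linearZ [RHS]scalerA mulrC -scalerA; congr (_ *: _).
by rewrite delta_rep /= -repM cP repM Pc linearZ.
Qed.

(** * Central elements and the scalars k[s, t] *)

Lemma weyl_central P :
  (forall b, P * weyl_gen k b = weyl_gen k b * P) -> central P.
Proof.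
move=> cP; elim/weyl_ind => [|Q Q' cQ cQ'|c Q cQ|b Q cQ].
- by rewrite mulr1 mul1r.
- by rewrite mulrDl mulrDr cQ cQ'.
- by rewrite -scalerAr cQ scalerAl.
by rewrite mulrA cP -mulrA cQ mulrA.
Qed.

(** The commutator of d with x^p is the derivative p x^(p-1), which vanishes. *)
Lemma central_xp : central (x ^+ p).
Proof.
apply: weyl_central => -[]; last by rewrite /= -exprSr exprS.
have := weyl_d_horner ('X^p : {poly k}).
rewrite rmorphXn /= horner_algX derivXn -mulr_natl -(rmorph_nat polyC) p0.
by rewrite rmorph0 mul0r rmorph0 addr0.
Qed.

Lemma central_dp : central (d ^+ p).
Proof.
apply: weyl_central => -[] /=; first by rewrite -exprSr exprS.
have dXx i : d ^+ i.+1 * x = x * d ^+ i.+1 + (d ^+ i) *+ i.+1.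
  exact: comm_expr_step (weyl_dx k) i.
by rewrite dXx -scaler_nat p0 scale0r addr0.
Qed.

Lemma rep_xp M : rep (x ^+ p) M = tofrac 'X%:P *: M.
Proof.
apply: rep_central_scalar central_xp _ _.
have -> : x ^+ p = weyl_of 'X^p%:P by rewrite weyl_ofC rmorphXn /= horner_algX.
rewrite rep_weyl_of; apply/matrixP => i j; rewrite [RHS]mxE.
rewrite -(polyC1 {poly k}) !residuesC residue_partXp residue_part1 -tofracM.
by congr tofrac; rewrite -mul_polyC !(polyC_natr, polyCM); ring.
Qed.

Lemma rep_dp M : rep (d ^+ p) M = tofrac 'X *: M.
Proof.
apply: rep_central_scalar central_dp _ _.
have -> : d ^+ p = weyl_of 'X^p.
  by rewrite /weyl_of rmorphXn /= map_polyX hornerXn.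
rewrite rep_weyl_of; apply/matrixP => i j; rewrite [RHS]mxE.
rewrite -(polyC1 {poly k}) residuesC residue_part1 mxE -tofracM; congr tofrac.
have -> : map_poly (residue_part n i) 'X^p = (i == ord0)%:R *: 'X^p :> B.
  apply/polyP => u; rewrite coef_map coefZ coefXn /=.
  by case: eqP => _; rewrite ?mulr0 ?raddf0 // mulr1 residue_part1.
by rewrite linearZ /= residue_partXp -!mul_polyC !polyC_natr; ring.
Qed.

(** Polynomials in x^p and d^p realize these scalars; this lets denominators be cleared inside the
    Weyl algebra. *)
Lemma rep_scalar (z : B) : exists P, forall M, rep P M = tofrac z *: M.
Proof.
have scD z1 z2 : (exists P, forall M, rep P M = tofrac z1 *: M) ->
    (exists P, forall M, rep P M = tofrac z2 *: M) ->
    exists P, forall M, rep P M = tofrac (z1 + z2) *: M.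
  move=> [P1 e1] [P2 e2]; exists (P1 + P2) => M.
  by rewrite repDl e1 e2 tofracD scalerDl.
have scM z1 z2 : (exists P, forall M, rep P M = tofrac z1 *: M) ->
    (exists P, forall M, rep P M = tofrac z2 *: M) ->
    exists P, forall M, rep P M = tofrac (z1 * z2) *: M.
  move=> [P1 e1] [P2 e2]; exists (P1 * P2) => M.
  by rewrite repM e2 e1 tofracM scalerA.
have sc0 : exists P, forall M, rep P M = tofrac 0 *: M.
  by exists (0 *: 1) => M; rewrite repZ /frac_const !polyC0 tofrac0 !scale0r.
elim/poly_ind: z => // z c IHz; apply: (scD _ _ (scM _ _ IHz _)).
  by exists (d ^+ p) => M; rewrite rep_dp.
elim/poly_ind: c => // c a IHc; rewrite polyCD polyCM.
apply: (scD _ _ (scM _ _ IHc _)); first by exists (x ^+ p) => M; rewrite rep_xp.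
by exists (a *: 1) => M; rewrite repZ rep1.
Qed.

End Rep.

Lemma fractionP (R : idomainType) (c : {fraction R}) :
  exists a b : R, b != 0 /\ tofrac b * c = tofrac a.
Proof.
elim/quotW: c => r; exists (\n_r), (\d_r); split; first exact: denom_ratioP.
rewrite -[LHS]/(FracField.mul _ _) !piE; apply/eqmodP => /=.
rewrite FracField.equivfE /FracField.mulf.
rewrite !numden_Ratio ?oner_eq0 ?mul1r ?denom_ratioP //.
by rewrite mulr1 mulrC.
Qed.

(** * The division algebra of fractions *)

Section Localization.
Variables (k : fieldType) (n : nat).
Local Notation p := n.+1.
Hypothesis p0 : p%:R = 0 :> k.
Local Notation A := (weyl k).
Local Notation B := {poly {poly k}}.
Local Notation K := {fraction B}.
Local Notation V := 'M[K]_p.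
Local Notation v0 := (residues n (1 : B)).
Local Notation rep := (@rep k n).
Import FalgLfun.

(* The product of 'End(V) is composition in the opposite order, so that
   [rep_end] is an antimorphism. *)
Definition rep_end (P : A) : 'End(V) := linfun (rep P).

(* e is the action of the fraction P / z, with z in k[s, t]. *)
Definition is_fraction (e : 'End(V)) : Prop :=
  exists z P, z != 0 /\ forall v, tofrac z *: e v = rep P v.

Lemma is_fraction_eq0 e : is_fraction e -> e v0 = 0 -> e = 0.
Proof.
move=> [z [P [z_neq0 eP]]] ev0; have P0 : P = 0.
  by apply: (rep_eq0 p0); rewrite -eP ev0 scaler0.
apply/lfunP => v; apply/eqP; rewrite lfunE /=.
have /eqP := eP v; rewrite P0 (additive0 (repDl p0 v)) scaler_eq0 tofrac_eq0.
by rewrite (negPf z_neq0).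
Qed.

Lemma is_fraction_rep P : is_fraction (rep_end P).
Proof.
by exists 1, P; split=> [|v]; rewrite ?oner_eq0 // tofrac1 scale1r lfunE.
Qed.

Lemma is_fractionD e f : is_fraction e -> is_fraction f -> is_fraction (e + f).
Proof.
move=> [z [P [z_neq0 eP]]] [y [Q [y_neq0 fQ]]].
have [[Z eZ] [Y eY]] := (rep_scalar p0 z, rep_scalar p0 y).
(* Common denominator, with Y and Z realizing the scalars y and z. *)
exists (z * y), (Y * P + Z * Q); split=> [|v]; first exact: mulf_neq0.
rewrite (repDl p0) !(repM p0) eZ eY -eP -fQ !scalerA -!tofracM.
by rewrite (mulrC y) -scalerDr add_lfunE.
Qed.

Lemma is_fractionZ c e : is_fraction e -> is_fraction (c *: e).
Proof.
move=> [z [P [z_neq0 eP]]]; have [a [b [b_neq0 bc]]] := fractionP c.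
have [Q eQ] := rep_scalar p0 a.
exists (b * z), (Q * P); split=> [|v]; first exact: mulf_neq0.
by rewrite (repM p0) eQ -eP scale_lfunE !scalerA -bc tofracM mulrAC.
Qed.

Lemma is_fractionM e f : is_fraction e -> is_fraction f -> is_fraction (e * f).
Proof.
move=> [z [P [z_neq0 eP]]] [y [Q [y_neq0 fQ]]].
(* The numerators appear reversed because [e * f] applies e first. *)
exists (z * y), (Q * P); split=> [|v]; first exact: mulf_neq0.
by rewrite (repM p0) -eP linearZ /= -fQ lfun_mulE scalerA tofracM.
Qed.

Lemma is_fraction_integral e f : is_fraction e -> is_fraction f ->
  e * f = 0 -> e = 0 \/ f = 0.
Proof.
move=> eF fF; have [z [P [z_neq0 eP]]] := eF; have [y [Q [y_neq0 fQ]]] := fF.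
move=> ef0; have QP0 : Q * P = 0.
  apply: (rep_eq0 p0); rewrite (repM p0) -eP linearZ /= -fQ -lfun_mulE ef0.
  by rewrite zero_lfunE !scaler0.
have [Q0|P0] := weyl_integral QP0; [right|left]; apply: is_fraction_eq0 => //.
  have /eqP := fQ v0; rewrite Q0 (additive0 (repDl p0 _)) scaler_eq0 tofrac_eq0.
  by rewrite (negPf y_neq0) => /eqP.
have /eqP := eP v0; rewrite P0 (additive0 (repDl p0 _)) scaler_eq0 tofrac_eq0.
by rewrite (negPf z_neq0) => /eqP.
Qed.

(* The fraction taking the value M at v0: fractions are determined by this
   value, which identifies their algebra with V and gives its dimension. *)
Definition fraction_of_value_fun (M : V) : 'End(V) :=
  \sum_i \sum_j M i j *: rep_end (weyl_of ('X^i *: 'X^j)).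

Lemma fraction_of_value_fun_linear : linear fraction_of_value_fun.
Proof.
move=> c M N; rewrite /fraction_of_value_fun scaler_sumr -big_split.
apply: eq_bigr => i _.
rewrite scaler_sumr -big_split; apply: eq_bigr => j _.
by rewrite !mxE scalerDl scalerA.
Qed.

HB.instance Definition _ :=
  GRing.isLinear.Build K V 'End(V) *:%R fraction_of_value_fun
    fraction_of_value_fun_linear.

Definition fraction_of_value : 'Hom(V, 'End(V)) := linfun fraction_of_value_fun.

Lemma fraction_of_valueE M : fraction_of_value M v0 = M.
Proof.
rewrite lfunE /= sum_lfunE [RHS]matrix_sum_delta; apply: eq_bigr => i _.
rewrite sum_lfunE; apply: eq_bigr => j _.
by rewrite scale_lfunE lfunE /= delta_rep.
Qed.

Lemma is_fraction_of_value M : is_fraction (fraction_of_value M).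
Proof.
rewrite lfunE /= /fraction_of_value_fun.
have frac0 : is_fraction 0.
  by rewrite -(scale0r (rep_end 1)); apply/is_fractionZ/is_fraction_rep.
elim/big_ind: _ => // [|i _]; first exact: is_fractionD.
elim/big_ind: _ => // [|j _]; first exact: is_fractionD.
exact/is_fractionZ/is_fraction_rep.
Qed.

Definition fraction_vspace : {vspace 'End(V)} := limg fraction_of_value.

(** A fraction e equals the one built from its value at [v0]: their difference is a fraction that
    kills [v0]. *)
Lemma is_fractionP e : reflect (is_fraction e) (e \in fraction_vspace).
Proof.
apply: (iffP memv_imgP) => [[M _ ->]|eF]; first exact: is_fraction_of_value.
exists (e v0); first exact: memvf.
apply/eqP; rewrite -subr_eq0; apply/eqP; apply: is_fraction_eq0.
  rewrite -scaleN1r; apply: is_fractionD => //.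
  exact/is_fractionZ/is_fraction_of_value.
move: (fraction_of_value (e v0)) (fraction_of_valueE (e v0)) => g gE.
by rewrite add_lfunE opp_lfunE gE subrr.
Qed.

Lemma fraction_aspace_subproof : is_aspace fraction_vspace.
Proof.
apply/andP; split.
  apply: has_algid1; apply/is_fractionP.
  exists 1, 1; split=> [|v]; first exact: oner_neq0.
  by rewrite tofrac1 scale1r lfunE (rep1 p0).
apply/prodvP => e f /is_fractionP eF /is_fractionP fF; apply/is_fractionP.
exact: is_fractionM.
Qed.

Definition fraction_aspace : {aspace 'End(V)} := ASpace fraction_aspace_subproof.

(** Evaluation at [v0] inverts [fraction_of_value], so the dimension is that of the matrix space. *)
Lemma dim_fraction_aspace : \dim fraction_aspace = (p * p)%N.
Proof.
rewrite limg_dim_eq ?dimvf //; apply/eqP; rewrite capfv; apply/lker0P => M N.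
by move=> eMN; rewrite -(fraction_of_valueE M) eMN fraction_of_valueE.
Qed.

(** In a finite-dimensional algebra without zero divisors, multiplication by a nonzero element is
    injective, hence bijective. *)
Lemma fraction_field : GRing.field_axiom (subvs_of fraction_aspace).
Proof.
apply: Falgebra_FieldMixin => u v /(congr1 val) /= uv0.
have uF : is_fraction (val u) by apply/is_fractionP; exact: subvsP.
have vF : is_fraction (val v) by apply/is_fractionP; exact: subvsP.
have [u0|w0] := is_fraction_integral uF vF uv0; apply/orP; [left|right].
  by apply/eqP/val_inj.
by apply/eqP/val_inj.
Qed.

Lemma rep_end_mem P : rep_end P \in fraction_aspace.
Proof. exact/is_fractionP/is_fraction_rep. Qed.

Definition localize (P : A) : subvs_of fraction_aspace := Subvs (rep_end_mem P).

Lemma rep_endM P Q : rep_end P * rep_end Q = rep_end (Q * P).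
Proof.
apply/lfunP => v; rewrite lfun_mulE [RHS]lfunE /= (repM p0).
by rewrite [X in rep_end Q X]lfunE [LHS]lfunE.
Qed.

Lemma rep_end_inj : injective rep_end.
Proof.
move=> P Q /lfunP/(_ v0); rewrite [LHS]lfunE [RHS]lfunE /= => ePQ.
apply/eqP; rewrite -subr_eq0; apply/eqP/(rep_eq0 p0).
by apply: (addIr (rep Q v0)); rewrite -(repDl p0) subrK add0r.
Qed.

(** [localize] reverses products but is injective, so it preserves and reflects commutation. *)
Lemma localize_comm P Q :
  localize P * localize Q = localize Q * localize P <-> P * Q = Q * P.
Proof.
have valM R S : val (localize R * localize S) = rep_end (S * R).
  exact: rep_endM.
split=> [/(congr1 val) | PQ]; first by rewrite !valM => /rep_end_inj.
by apply: val_inj; rewrite !valM PQ.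
Qed.

End Localization.

(** * Centralizers *)

(** Here l = p^i and c = p^j with i <= j <= 2; excluding i = 0 and j = 2 leaves i = j = 1. *)
Lemma dvdn_chain_sqr (p l c : nat) : prime p -> (l %| c)%N ->
  (c %| p * p)%N -> l != 1%N -> c != (p * p)%N -> l = c.
Proof.
move=> p_pr lc; rewrite mulnn => /(dvdn_pfactor _ _ p_pr)[j le_j2 ec].
move: lc; rewrite ec => /(dvdn_pfactor _ _ p_pr)[i le_ij ->].
by case: i j le_j2 le_ij {ec} => [|[|[|i]]] [|[|[|j]]] //; rewrite eqxx.
Qed.

Lemma skew_field_centralizer_comm (K : fieldType) (D : falgType K) (p : nat)
    (a y : D) :
  GRing.field_axiom D -> prime p -> \dim {:D} = (p * p)%N ->
  a * y <> y * a -> {in 'C[a]%VS &, commutative (@GRing.mul D)}.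
Proof.
move=> fieldD p_pr dimD nay.
pose L : {aspace D} := << <[a]> >>%AS.
have aL : a \in L by rewrite memvE sub_agenv.
have sLC : (L <= 'C[a])%VS.
  by rewrite agenv_sub_modl -?memvE ?cent1v1 // prodv_sub // -memvE cent1v_id.
have eLC : L = 'C[a]%VS :> {vspace D}.
  suff dimLC : \dim L = \dim 'C[a] by apply/eqP; rewrite eqEdim sLC dimLC /=.
  apply: dvdn_chain_sqr p_pr _ _ _ _.
  (* Dimensions divide because an algebra is a free module over a division subalgebra. *)
  - exact: (skew_field_dimS fieldD (B := 'C[a]%AS)).
  - rewrite -dimD.
    apply: (skew_field_dimS fieldD (A := 'C[a]%AS) (B := aspacef _)).
    exact: subvf.
  (* If L had dimension 1, a would be a scalar and commute with y. *)
  - apply/negP => /adim1P L1; apply: nay.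
    move: aL; rewrite L1 skew_field_algid1 // => /vlineP[c ->].
    by rewrite mulr_algl mulr_algr.
  rewrite -dimD; apply/negP => /eqP dimC; have /eqP eC : 'C[a]%VS == fullv.
    by rewrite eqEdim subvf dimC /=.
  by apply: nay; apply/esym/cent1vP; rewrite eC memvf.
(* The centralizer of b is an algebra containing a, hence it contains L and thus c. *)
move=> b c bC; rewrite -eLC => cL; apply/cent1vP; rewrite cent1vC.
apply: subvP cL; rewrite agenv_sub_modl -?memvE ?cent1v1 // prodv_sub //.
by rewrite -memvE cent1vC.
Qed.

Theorem mainTheorem2 (k : fieldType) (p : nat) (hp : p \in [pchar k])
    (P : weyl k) (hP : ~ central P) :
  GRing.subalg_closed (centralizer P) /\
  {in centralizer P &, commutative (@GRing.mul (weyl k))}.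
Proof.
split.
  split=> [|c Q R /eqP PQ /eqP PR|Q R /eqP PQ /eqP PR]; apply/eqP.
  - by rewrite mulr1 mul1r.
  - by rewrite mulrDr mulrDl -scalerAr PQ PR scalerAl.
  by rewrite mulrA PQ -mulrA PR mulrA.
(* By contraposition, non-commuting Q and R must force P to commute with every S. A second
   contraposition makes an S with P S <> S P the witness of noncentrality in the division
   algebra. *)
move=> Q R /eqP PQ /eqP PR; apply/eqP; apply: contra_notT hP => QR S.
have /andP[p_prime /eqP p0] := hp.
case: p hp p_prime p0 => // n _ p_prime p0.
apply/eqP; apply: contraNT QR => /eqP PS; apply/eqP/(localize_comm p0).
have dimF : \dim {:subvs_of (fraction_aspace p0)} = (n.+1 * n.+1)%N.
  by rewrite dimvf; exact: dim_fraction_aspace.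
have nPS : localize p0 P * localize p0 S <> localize p0 S * localize p0 P.
  by move/(localize_comm p0).
have cP T : P * T = T * P -> localize p0 T \in 'C[localize p0 P]%VS.
  by move=> PT; apply/cent1vP/(localize_comm p0).
have comm := skew_field_centralizer_comm (@fraction_field k n p0) p_prime dimF nPS.
exact: comm _ _ (cP Q PQ) (cP R PR).
Qed.
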